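(* Let $A$ and $B$ be two nonempty, closed and convex subsets of a uniformly convex Banach space $X$. Let $T:(A \times B) \cup (B \times A) \rightarrow A \cup B$ be a p-cyclic contraction mapping. Then $T$ has a unique coupled best proximity point. Moreover, the coupled best proximity point problem for $T$ is Ulam-Hyers stable.
   Context: For nonempty subsets $A,B$ of a Banach space $(X,\Vert\cdot\Vert)$, $dist(A,B):=\inf\{\Vert a-b\Vert : a\in A,\ b\in B\}$. The space $X\times X$ carries the norm $\Vert (x,y)\Vert=\max\{\Vert x\Vert,\Vert y\Vert\}$. p-cyclic contraction: a mapping $T:(A \times B) \cup (B \times A) \rightarrow A \cup B$ is a p-cyclic contraction mapping if (i) $T(A\times B)\subset B$ and $T(B\times A)\subset A$; (ii) there is some $\lambda\in(0,1)$ such that $\Vert T(x_1,y_1)-T(x_2,y_2)\Vert\le \lambda\Vert (x_1,y_1)-(x_2,y_2)\Vert+(1-\lambda)\,dist(A,B)$ for all $(x_1,y_1),(x_2,y_2)\in (A\times B)\cup(B\times A)$. Coupled best proximity point (or pair) of $T$: a pair $(x,y)\in A\times B$ with $\Vert x-T(x,y)\Vert=dist(A,B)$ and $\Vert y-T(y,x)\Vert=dist(A,B)$. Ulam-Hyers stability: the coupled best proximity point problem for $T$ is Ulam-Hyers stable if for each $\epsilon>0$ and each $(u,v)\in A\times B$ satisfying $\Vert u-T(u,v)\Vert\le\epsilon+dist(A,B)$ and $\Vert v-T(v,u)\Vert\le\epsilon+dist(A,B)$, there exist $\alpha,\beta>0$ and a coupled best proximity point $(x^*,y^* )$ of $T$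 such that $\Vert x^*-u\Vert\le\alpha\epsilon+\beta\, dist(A,B)$ and $\Vert y^*-v\Vert\le\alpha\epsilon+\beta\, dist(A,B)$. *)

(* Defs.v *)
From HB Require Import structures.
From mathcomp Require Import all_boot all_order all_algebra.
From mathcomp Require Import all_classical all_reals all_analysis.

Set Implicit Arguments.
Unset Strict Implicit.
Unset Printing Implicit Defensive.

Import Order.TTheory GRing.Theory Num.Theory.
Import numFieldNormedType.Exports.

Local Open Scope classical_set_scope.
Local Open Scope ring_scope.

Definition uniformly_convex (R : realType) (X : normedModType R) : Prop :=
  forall eps : R, 0 < eps -> eps <= 2 ->
    exists2 delta : R, 0 < delta &
      forall x y : X, `|x| <= 1 -> `|y| <= 1 -> eps <= `|x - y| ->
        `|2^-1 *: (x + y)| <= 1 - delta.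

(* Used for nonempty A and B; inf is 0 by convention on the empty set. *)
Definition set_dist (R : realType) (X : normedModType R) (A B : set X) : R :=
  inf [set `|a - b| | a in A & b in B].

(* T is a total function, but only its values on (A x B) u (B x A) matter, here
   and below.  The norm on X * X is the library's norm on products, which is the
   max of the norms of the components (prod_normE). *)
Definition p_cyclic_contraction (R : realType) (X : normedModType R)
    (A B : set X) (T : X * X -> X) : Prop :=
  [/\ T @` (A `*` B) `<=` B,
      T @` (B `*` A) `<=` A &
      exists lambda : R, [/\ 0 < lambda, lambda < 1 &
        forall p q : X * X,
          (A `*` B `|` B `*` A) p -> (A `*` B `|` B `*` A) q ->
          `|T p - T q| <= lambda * `|p - q| + (1 - lambda) * set_dist A B]].

Definition coupled_best_proximity_point (R : realType) (X : normedModType R)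
    (A B : set X) (T : X * X -> X) (p : X * X) : Prop :=
  [/\ (A `*` B) p,
      `|p.1 - T (p.1, p.2)| = set_dist A B &
      `|p.2 - T (p.2, p.1)| = set_dist A B].

(* alpha and beta may depend on eps, u and v: no uniform constants are required. *)
Definition Ulam_Hyers_stable (R : realType) (X : normedModType R)
    (A B : set X) (T : X * X -> X) : Prop :=
  forall eps : R, 0 < eps ->
  forall u v : X, (A `*` B) (u, v) ->
    `|u - T (u, v)| <= eps + set_dist A B ->
    `|v - T (v, u)| <= eps + set_dist A B ->
    exists alpha beta : R, [/\ 0 < alpha, 0 < beta &
      exists2 p : X * X, coupled_best_proximity_point A B T p &
        `|p.1 - u| <= alpha * eps + beta * set_dist A B /\
        `|p.2 - v| <= alpha * eps + beta * set_dist A B].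

(* Main.v *)
(** The map [G (x, y) = (T (x, y), T (y, x))] is a cyclic contraction between
    [A `*` B] and [B `*` A] for the max norm, and the coupled best proximity
    points of [T] are the points [p] of [A `*` B] with [`|p - G p| = d], where
    [d] is the distance from [A] to [B].  The contraction inequality holds for
    all pairs of points of [A `*` B `|` B `*` A], so any two points of an orbit
    of [G] from rank [N] on are within [d + M * lambda ^+ N] of each other.
    Uniform convexity makes two points of a convex set close to each other as
    soon as they almost realize the distance to a common point of the other set;
    applied coordinatewise, it shows that the even terms of the orbit converge,
    and that [G \o G] fixes the best proximity points, whence uniqueness. *)

Require Import Defs.
From mathcomp Require Import all_boot all_order all_algebra.
From mathcomp Require Import all_classical all_reals all_analysis.
From mathcomp Require Import lra.

Import Order.TTheory GRing.Theory Num.Theory.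
Import numFieldNormedType.Exports.

Local Open Scope classical_set_scope.
Local Open Scope ring_scope.

Set Implicit Arguments.
Unset Strict Implicit.

(** * Midpoints and uniform convexity *)

Lemma convex_set_midpoint (R : realType) (X : normedModType R) (A : set X)
    (x y : X) :
  convex_set A -> A x -> A y -> A (2^-1 *: (x + y)).
Proof.
move=> cA Ax Ay; have h0 : (0 : R) <= 2^-1 by rewrite invr_ge0.
have h1 : (2^-1 : R) <= 1 by rewrite invf_le1// ler1n.
have := cA x y (Itv01 h0 h1) (mem_set Ax) (mem_set Ay).
rewrite inE /conv/= scalerDr /unstable.onem.
by have -> : (1 - 2^-1 : R) = 2^-1 by lra.
Qed.

Lemma normr_prod_le (R : realType) (X : normedModType R) (p : X * X) (r : R) :
  (`|p| <= r) = (`|p.1| <= r) && (`|p.2| <= r).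
Proof. by rewrite prod_normE ge_max. Qed.

(** Otherwise, scaling [x - y] and [z - y] into the unit ball by [(d + eta)^-1] puts the midpoint of
    [x] and [z], a point of [A], within [(d + eta) * (1 - delta) < d] of [y]. *)
Lemma uniformly_convex_close (R : realType) (X : normedModType R)
    (A : set X) (d eps : R) :
  uniformly_convex X -> convex_set A -> 0 <= d -> 0 < eps ->
  exists2 eta : R, 0 < eta & forall x z y : X, A x -> A z ->
    (forall a, A a -> d <= `|a - y|) ->
    `|x - y| <= d + eta -> `|z - y| <= d + eta -> `|x - z| < eps.
Proof.
move=> hX cA d0 eps0; move: d0; rewrite le_eqVlt => /predU1P[<-|d0].
  (* For [d = 0] the gap [d * delta] vanishes, but the triangle inequality suffices. *)
  exists (eps / 4) => [|x z y _ _ _ hx hz]; first by rewrite divr_gt0.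
  have := ler_distD y x z; rewrite (distrC y z); lra.
(* As [eta <= 1], a separation [eps] is still at least [eps / (d + 1)] after scaling; the cap 2 is
   the range of the modulus. *)
pose e := Num.min (eps / (d + 1)) 2.
have e0 : 0 < e by rewrite lt_min divr_gt0//=; lra.
have e2 : e <= 2 by rewrite ge_min lexx orbT.
have [delta delta0 hdelta] := hX _ e0 e2.
have dd0 : 0 < d * delta by rewrite mulr_gt0.
pose eta := Num.min 1 (d * delta / 2).
have eta0 : 0 < eta by rewrite lt_min ltr01/= divr_gt0.
have eta1 : eta <= 1 by rewrite ge_min lexx.
have etad : eta <= d * delta / 2 by rewrite ge_min lexx orbT.
exists eta => // x z y Ax Az dy hx hz; rewrite ltNge; apply/negP => xz.
have r0 : 0 < d + eta by lra.
pose s := (d + eta)^-1.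
have s0 : 0 < s by rewrite invr_gt0.
have scale_le1 (w : X) : `|w| <= d + eta -> `|s *: w| <= 1.
  by move=> hw; rewrite normrZ gtr0_norm// mulrC ler_pdivrMr// mul1r.
have sep : e <= `|s *: (x - y) - s *: (z - y)|.
  rewrite -scalerBr opprB addrA subrK normrZ gtr0_norm//.
  rewrite ge_min; apply/orP; left; rewrite mulrC ler_pM//.
  - by rewrite invr_ge0; lra.
  - exact: ltW.
  - by rewrite lef_pV2 ?posrE//; lra.
have := hdelta _ _ (scale_le1 _ hx) (scale_le1 _ hz) sep.
rewrite -scalerDr scalerA mulrC -scalerA normrZ gtr0_norm// mulrC.
rewrite ler_pdivrMr//.
have -> : 2^-1 *: (x - y + (z - y)) = 2^-1 *: (x + z) - y.
  rewrite addrACA -opprD scalerBr; congr (_ - _).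
  by rewrite -mulr2n -[y *+ 2]scaler_nat scalerA mulVf ?scale1r ?pnatr_eq0.
have := dy _ (convex_set_midpoint cA Ax Az).
have : 0 <= eta * delta by rewrite mulr_ge0// ltW.
lra.
Qed.

Lemma eq_of_common_proximal (R : realType) (X : normedModType R)
    (A : set X) (d : R) (x z y : X) :
  uniformly_convex X -> convex_set A -> 0 <= d -> A x -> A z ->
  (forall a, A a -> d <= `|a - y|) ->
  `|x - y| <= d -> `|z - y| <= d -> x = z.
Proof.
move=> hX cA d0 Ax Az dy hx hz; apply/eqP; rewrite -subr_eq0 -normr_le0.
apply/ler_addgt0Pl => e e0; rewrite addr0.
have [eta eta0 h] := uniformly_convex_close hX cA d0 e0.
by apply/ltW/(h _ _ y) => //; rewrite (le_trans hx, le_trans hz)// lerDl ltW.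
Qed.

Lemma alternating_cvg (R : realType) (X : completeNormedModType R)
    (A B : set X) (d : R) (z : nat -> X) (e : nat -> R) :
  uniformly_convex X -> convex_set A -> closed A -> 0 <= d ->
  (forall a b, A a -> B b -> d <= `|a - b|) ->
  (forall n, A (z n.*2)) -> (forall n, B (z n.*2.+1)) ->
  e n @[n --> \oo] --> 0 ->
  (forall N i j, (N <= i)%N -> (N <= j)%N -> `|z i - z j| <= d + e N) ->
  exists2 l, A l & z n.*2 @[n --> \oo] --> l.
Proof.
move=> hX cA clA d0 dAB Az Bz e0 ze.
suff cz : cvg (z n.*2 @[n --> \oo]).
  exists (lim (z n.*2 @[n --> \oo])) => //.
  by apply: closed_cvg cz => //; apply: nearW.
apply/cauchy_cvgP/cauchy_exP => eps eps0.
have [eta eta0 close] := uniformly_convex_close hX cA d0 eps0.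
have [N _ eN] : \forall N \near \oo, `|0 - e N| <= eta.
  by move/cvgrPdist_le: e0; apply.
have {}eN : e N <= eta.
  by apply: le_trans (eN N (leqnn N)); rewrite sub0r normrN ler_norm.
exists (z N.*2); exists N => // n /= Nn; rewrite -ball_normE /=.
have N2 m : (N <= m -> N <= m.*2)%N.
  by move=> /leq_trans; apply; rewrite -addnn leq_addr.
(* The odd term of rank [N.*2.+1] is the common point of [B] that all later even terms, and
   [z N.*2], nearly realize [d] to. *)
apply: (close _ _ (z N.*2.+1)) => // [a Aa||]; first exact: dAB.
- by rewrite (le_trans (ze N _ _ _ _)) ?lerD2l// ?leqW// N2.
- by rewrite (le_trans (ze N _ _ _ _)) ?lerD2l// ?leqW// N2.
Qed.

(** * The coupled map as a cyclic contraction *)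

Section CoupledProximity.
Context (R : realType) (X : completeNormedModType R) (A B : set X).
Context (T : X * X -> X) (lambda : R).

Let d := set_dist A B.
Let D := A `*` B `|` B `*` A.
Let G (p : X * X) : X * X := (T (p.1, p.2), T (p.2, p.1)).

Hypotheses (TAB : T @` (A `*` B) `<=` B) (TBA : T @` (B `*` A) `<=` A).
Hypotheses (lambda_gt0 : 0 < lambda) (lambda_lt1 : lambda < 1).
Hypothesis T_contr : forall p q : X * X, D p -> D q ->
  `|T p - T q| <= lambda * `|p - q| + (1 - lambda) * d.

Lemma set_dist_le a b : A a -> B b -> d <= `|a - b|.
Proof.
move=> Aa Bb; apply: ge_inf; last by exists a => //; exists b.
by exists 0 => _ [x _ [y _ <-]].
Qed.

Lemma set_dist_ge0 : A !=set0 -> B !=set0 -> 0 <= d.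
Proof.
move=> [a Aa] [b Bb]; apply: lb_le_inf; last by move=> _ [x _ [y _ <-]].
by exists `|a - b|, a => //; exists b.
Qed.

Lemma coupled_map_AB p : (A `*` B) p -> (B `*` A) (G p).
Proof.
move=> [Ap Bp]; split; first by apply: TAB; exists (p.1, p.2).
by apply: TBA; exists (p.2, p.1).
Qed.

Lemma coupled_map_BA p : (B `*` A) p -> (A `*` B) (G p).
Proof.
move=> [Bp Ap]; split; first by apply: TBA; exists (p.1, p.2).
by apply: TAB; exists (p.2, p.1).
Qed.

Lemma coupled_map_D p : D p -> D (G p).
Proof. by move=> [/coupled_map_AB|/coupled_map_BA]; [right|left]. Qed.

Lemma coupled_map_contr p q : D p -> D q ->
  `|G p - G q| <= lambda * `|p - q| + (1 - lambda) * d.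
Proof.
have Dswap r : D r -> D (r.2, r.1) by move=> [[]|[]]; [right|left].
case: p q => [p1 p2] [q1 q2] Dp Dq; rewrite normr_prod_le /=.
rewrite T_contr//=.
have /= := T_contr (Dswap _ Dp) (Dswap _ Dq).
by rewrite !prod_normE/= maxC.
Qed.

(** The reverse inequalities are automatic, since matching coordinates of [p] and [G p] lie in
    opposite sets. *)
Lemma cbppE p :
  coupled_best_proximity_point A B T p <-> (A `*` B) p /\ `|p - G p| <= d.
Proof.
split=> [[ABp h1 h2]|[ABp]].
  by split => //; rewrite normr_prod_le /= h1 h2 !lexx.
have [/= Bp Ap] := coupled_map_AB ABp; have [Ap1 Bp2] := ABp.
rewrite normr_prod_le /= => /andP[h1 h2]; split => //; apply/le_anti.
  by rewrite h1 set_dist_le.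
by rewrite h2 distrC set_dist_le.
Qed.

(** * Orbits of the coupled map *)

Section Orbit.
Context (p0 : X * X) (ABp0 : (A `*` B) p0) (d_ge0 : 0 <= d).
Let p n := iter n G p0.
Let M := `|p0 - G p0| / (1 - lambda).

Lemma orbit_even n : (A `*` B) (p n.*2).
Proof. by elim: n => //= n /coupled_map_AB/coupled_map_BA. Qed.

Lemma orbit_odd n : (B `*` A) (p n.*2.+1).
Proof. exact/coupled_map_AB/orbit_even. Qed.

Lemma orbit_D n : D (p n).
Proof. by elim: n => [|n]; [left|exact: coupled_map_D]. Qed.

(* [d + M] is the fixed point of the bound
   [`|p0 - G p0| + lambda * r + (1 - lambda) * d] on [`|p0 - p n.+1|] in terms
   of [r = `|p0 - p n|]. *)
Lemma orbit_bounded n : `|p0 - p n| <= d + M.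
Proof.
have M0 : 0 <= M by rewrite divr_ge0// subr_ge0 ltW.
have ME : M * (1 - lambda) = `|p0 - G p0|.
  by rewrite divfK// subr_eq0 gt_eqF.
elim: n => [|n IH]; first by rewrite subrr normr0 addr_ge0.
have h := coupled_map_contr (orbit_D 0) (orbit_D n).
have l : lambda * `|p0 - p n| <= lambda * (d + M) by rewrite ler_pM2l.
have := ler_distD (G p0) p0 (p n.+1).
rewrite -ME; move: h l; rewrite /= -/(p n); lra.
Qed.

(** Each application of [G] multiplies the excess over [d] by [lambda], as [lambda * (d + r) + (1 -
    lambda) * d = d + lambda * r]. *)
Lemma orbit_dist N i j : (N <= i)%N -> (N <= j)%N ->
  `|p i - p j| <= d + geometric M lambda N.
Proof.
elim: N i j => [|N IH] i j.
  wlog ij : i j / (i <= j)%N => [W _ _|_ _].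
    by case/orP: (leq_total i j) => h; [|rewrite distrC]; apply: W.
  rewrite /= mulr1; have M0 : 0 <= M by rewrite divr_ge0// subr_ge0 ltW.
  (* Both indices are lowered together until the smaller is 0. *)
  elim: i j ij => [|i IHi] [|j]// ij; try exact: orbit_bounded.
  have h := coupled_map_contr (orbit_D i) (orbit_D j).
  have l : lambda * `|p i - p j| <= lambda * (d + M) by rewrite ler_pM2l// IHi.
  have : lambda * M <= M by rewrite ler_piMl// ltW.
  move: h l; rewrite /= -/(p i) -/(p j); lra.
case: i j => [//|i] [//|j] Ni Nj.
have h := coupled_map_contr (orbit_D i) (orbit_D j).
have : lambda * `|p i - p j| <= lambda * (d + geometric M lambda N).
  by rewrite ler_pM2l// IH.
move: h; rewrite /= -/(p i) -/(p j) exprS; lra.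
Qed.

(** The contraction bound does not yield continuity of [G] when [d > 0]. Instead [G l] is compared
    with [p n.+1.*2 = G (p n.*2.+1)], where [p n.*2.+1] is almost within [d] of [l]. *)
Lemma proximal_limit l : (A `*` B) l -> p n.*2 @[n --> \oo] --> l ->
  `|l - G l| <= d.
Proof.
move=> ABl pl; apply/ler_addgt0Pr => e e0.
have e3 : 0 < e / 3 by rewrite divr_gt0.
have geo : geometric M lambda n @[n --> \oo] --> 0.
  by apply: cvg_geometric; rewrite gtr0_norm.
have [K _ hK] : \forall n \near \oo, `|l - p n.*2| <= e / 3.
  by move/cvgrPdist_le: pl; apply.
have [N _ hN] : \forall n \near \oo, `|0 - geometric M lambda n| <= e / 3.
  by move/cvgrPdist_le: geo; apply.
pose n := maxn K N.
have Nn2 : (N <= n.*2)%N.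
  by rewrite -addnn (leq_trans _ (leq_addr _ _))// leq_maxr.
have hn := hK n (leq_maxl _ _); have hn1 := hK n.+1 (leqW (leq_maxl _ _)).
have eN : geometric M lambda N <= e / 3.
  by apply: le_trans (hN N (leqnn N)); rewrite sub0r normrN ler_norm.
have st := orbit_dist (leqW Nn2) Nn2.
have Dl : D l by left.
have c := coupled_map_contr (orbit_D n.*2.+1) Dl.
have t1 := ler_distD (p n.+1.*2) l (G l).
have t2 := ler_distD (p n.*2) (p n.*2.+1) l; rewrite (distrC (p n.*2) l) in t2.
have : lambda * `|p n.*2.+1 - l| <= lambda * (d + e / 3 + e / 3).
  by rewrite ler_pM2l//; lra.
have : lambda * (e / 3) <= e / 3 by rewrite ler_piMl// ltW.
move: c t1 hn1; rewrite doubleS /= -/(p n.*2) -/(p n.*2.+1); lra.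
Qed.

End Orbit.

(** * Existence and uniqueness *)

Section Convex.
Hypotheses (hX : uniformly_convex X) (d_ge0 : 0 <= d).
Hypotheses (A_convex : convex_set A) (B_convex : convex_set B).

Lemma set_dist_le_sym b a : B b -> A a -> d <= `|b - a|.
Proof. by rewrite distrC => Bb Aa; apply: set_dist_le. Qed.

Lemma cbpp_exists : A !=set0 -> B !=set0 -> closed A -> closed B ->
  exists p, coupled_best_proximity_point A B T p.
Proof.
move=> [a Aa] [b Bb] clA clB; have AB : (A `*` B) (a, b) by [].
set M := `|(a, b) - G (a, b)| / (1 - lambda).
have geo : geometric M lambda n @[n --> \oo] --> 0.
  by apply: cvg_geometric; rewrite gtr0_norm.
have dist N i j (Ni : (N <= i)%N) (Nj : (N <= j)%N) :=
  orbit_dist AB d_ge0 Ni Nj.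
have dist1 N i j : (N <= i)%N -> (N <= j)%N ->
    `|(iter i G (a, b)).1 - (iter j G (a, b)).1| <= d + geometric M lambda N.
  by move=> /dist/[apply]; rewrite normr_prod_le => /andP[].
have dist2 N i j : (N <= i)%N -> (N <= j)%N ->
    `|(iter i G (a, b)).2 - (iter j G (a, b)).2| <= d + geometric M lambda N.
  by move=> /dist/[apply]; rewrite normr_prod_le => /andP[].
have [x Ax cx] := alternating_cvg hX A_convex clA d_ge0
  set_dist_le (fun n => (orbit_even AB n).1) (fun n => (orbit_odd AB n).1)
  geo dist1.
(* Second coordinates start in [B], so [A] and [B] exchange roles. *)
have [y By cy] := alternating_cvg hX B_convex clB d_ge0
  set_dist_le_sym (fun n => (orbit_even AB n).2)
  (fun n => (orbit_odd AB n).2) geo dist2.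
exists (x, y); apply/cbppE; split => //.
apply: (proximal_limit AB d_ge0) => //.
rewrite (_ : (fun n => _) = fun n =>
  ((iter n.*2 G (a, b)).1, (iter n.*2 G (a, b)).2)); first exact: cvg_pair.
by apply/funext => n; case: (iter _ _ _).
Qed.

Lemma eq_of_common_proximal_AB p q r : (A `*` B) p -> (A `*` B) q ->
  (B `*` A) r -> `|p - r| <= d -> `|q - r| <= d -> p = q.
Proof.
case: p q r => [p1 p2] [q1 q2] [r1 r2] [/= Ap Bp] [/= Aq Bq] [/= Br Ar].
rewrite !normr_prod_le /= => /andP[pr1 pr2] /andP[qr1 qr2].
congr pair.
  by apply: (eq_of_common_proximal (y := r1) hX A_convex d_ge0) => // a Aa;
    apply: set_dist_le.
by apply: (eq_of_common_proximal (y := r2) hX B_convex d_ge0) => // b Bb;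
  apply: set_dist_le_sym.
Qed.

(** Contraction keeps [G (G p)] within [d] of [G p], as [p] is. *)
Lemma cbpp_fixed p : (A `*` B) p -> `|p - G p| <= d -> G (G p) = p.
Proof.
move=> ABp pd; have BAGp := coupled_map_AB ABp.
apply: (eq_of_common_proximal_AB (r := G p)) => //; first exact: coupled_map_BA.
have Dp : D p by left.
have := coupled_map_contr (coupled_map_D Dp) Dp; rewrite (distrC _ p).
have : lambda * `|p - G p| <= lambda * d by rewrite ler_pM2l.
lra.
Qed.

(** It suffices that [t = |p - G q|] is at most [d]. As [G \o G] fixes [p] and [q], two contractions
    give [t - d <= lambda ^+ 2 * (t - d)]. *)
Lemma cbpp_unique p q : coupled_best_proximity_point A B T p ->
  coupled_best_proximity_point A B T q -> p = q.
Proof.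
move=> /cbppE[ABp pd] /cbppE[ABq qd].
have Dp : D p by left.
have Dq : D q by left.
apply: (eq_of_common_proximal_AB (r := G q)) => //; first exact: coupled_map_AB.
have := coupled_map_contr (coupled_map_D Dp) Dq.
have := coupled_map_contr Dp (coupled_map_D Dq).
rewrite !cbpp_fixed//; set s := `|G p - q|; set t := `|p - G q| => hs ht.
rewrite -subr_le0 -(pmulr_rle0 _ (_ : 0 < (1 - lambda) * (1 + lambda))).
  have : lambda * s <= lambda * (lambda * t + (1 - lambda) * d).
    by rewrite ler_pM2l.
  nra.
by rewrite mulr_gt0// ?subr_gt0// addr_gt0.
Qed.

End Convex.

(** * Stability *)

(** Going through [p], [G p], [G u], [u] gives [|p - u| <= lambda * |p - u| + eps + (3 - lambda) *
    d], which is solved for [|p - u|]. *)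
Lemma cbpp_stable p u eps : coupled_best_proximity_point A B T p ->
  (A `*` B) u -> `|u - G u| <= eps + d ->
  `|p - u| <= (1 - lambda)^-1 * eps + ((3 - lambda) / (1 - lambda)) * d.
Proof.
move=> /cbppE[ABp pd] ABu ud.
have Dp : D p by left.
have Du : D u by left.
have l1 : 0 < 1 - lambda by rewrite subr_gt0.
rewrite mulrAC (mulrC _ eps) -mulrDl ler_pdivlMr//.
have := coupled_map_contr Dp Du.
have := ler_distD (G p) p u; have := ler_distD (G u) (G p) u.
rewrite (distrC (G u) u); lra.
Qed.

End CoupledProximity.

Unset Implicit Arguments.

Theorem theorem2p6 (R : realType) (X : completeNormedModType R)
    (A B : set X) (T : X * X -> X)
    (hX : uniformly_convex X)
    (A_nonempty : A !=set0) (B_nonempty : B !=set0)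
    (A_closed : closed A) (B_closed : closed B)
    (A_convex : convex_set A) (B_convex : convex_set B)
    (hT : p_cyclic_contraction A B T) :
  (exists! p : X * X, coupled_best_proximity_point A B T p) /\
  Ulam_Hyers_stable A B T.
Proof.
case: hT => TAB TBA [lambda [l0 l1 contr]].
have d0 := set_dist_ge0 A_nonempty B_nonempty.
have [p hp] := cbpp_exists TAB TBA l0 l1 contr hX d0
  A_convex B_convex A_nonempty B_nonempty A_closed B_closed.
split.
  exists p; split => // q hq.
  exact: (cbpp_unique TAB TBA l0 l1 contr hX d0).
move=> eps eps0 u v ABuv hu hv.
(* Both constants depend on [lambda] only. *)
exists (1 - lambda)^-1, ((3 - lambda) / (1 - lambda)); split.
- by rewrite invr_gt0 subr_gt0.
- by rewrite divr_gt0//; lra.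
exists p => //.
have : `|(u, v) - (T (u, v), T (v, u))| <= eps + set_dist A B.
  by rewrite normr_prod_le /= hu.
move=> /(cbpp_stable TAB TBA l1 contr hp ABuv).
by rewrite normr_prod_le => /andP[].
Qed.
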